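(* Let $X$ be a compact, connected metric space such that $\mathcal{C}(X)$ is compact, and let $f\in\mathcal{C}(X)$. Then $(X,f)$ has shadowing if and only if the sequence of iterates $\langle f^n\rangle$ converges in $\mathcal{C}(X)$ (i.e. uniformly) to a constant map.
   Context: For a compact metric space $(X,d)$, $\mathcal{C}(X)$ is the space of continuous maps $f:X\to X$ with the supremum metric $\rho(f,g)=\sup_{x\in X}d(f(x),g(x))$; $\omega$ denotes the non-negative integers. For $\delta>0$, a $\delta$-pseudo-orbit for $f$ is a sequence $\langle x_i\rangle_{i\in\omega}$ in $X$ with $d(f(x_i),x_{i+1})<\delta$ for all $i\in\omega$. $(X,f)$ has shadowing if for every $\epsilon>0$ there is $\delta>0$ such that for every $\delta$-pseudo-orbit $\langle x_i\rangle$ for $f$ there is $z\in X$ with $d(x_i,f^i(z))<\epsilon$ for all $i\in\omega$. *)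

(* Defs.v *)
From HB Require Import structures.
From mathcomp Require Import all_boot all_order all_algebra.
From mathcomp Require Import all_classical all_reals all_analysis.

Set Implicit Arguments.
Unset Strict Implicit.
Unset Printing Implicit Defensive.

Import Order.TTheory GRing.Theory Num.Theory.
Import numFieldNormedType.Exports.

Local Open Scope classical_set_scope.
Local Open Scope ring_scope.

(* Compactness of [X] is a parameter of the type: it makes the supremum below
   finite ([sup] of an unbounded set is 0), hence [rho] a metric. *)
Definition cmap {R : realType} {X : metricType R}
  (cX : compact [set: X]) : Type := continuousType X X.

Definition rho {R : realType} {X : metricType R} (f g : X -> X) : R :=
  sup (range (fun x => mdist (f x) (g x))).

Section sup_metric.
Context {R : realType} {X : metricType R} (cX : compact [set: X]).

HB.instance Definition _ := Choice.copy (cmap cX) (continuousType X X).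

Lemma compact_mdist_bounded : exists M : R, forall x y : X, mdist x y <= M.
Proof.
have [[p _]|X0] := pselect (exists p : X, True); last first.
  by exists 0 => x; exfalso; apply: X0; exists x.
have /compact_near_coveringP/(_ nat \oo
  (fun n x => mdist p x <= n%:R) eventually_filter) := cX.
case=> [x _|n _ Hn].
  exists (ball x 1, [set n : nat | mdist p x + 1 <= n%:R]) => /=.
    split; first by apply: nbhsx_ballx; exact: ltr01.
    exact: nbhs_infty_ger.
  move=> [y n] /= [xy]; apply: le_trans.
  apply: le_trans (metric_triangle p x y) _; rewrite lerD2l ltW//.
  by move: xy; rewrite ballEmdist.
exists (n%:R + n%:R) => x y; apply: le_trans (metric_triangle x p y) _.
by rewrite metric_sym; apply: lerD; apply: (Hn n) => //=.
Qed.

Lemma rho_has_ubound (f g : X -> X) :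
  has_ubound (range (fun x => mdist (f x) (g x))).
Proof.
by have [M HM] := compact_mdist_bounded; exists M => _ [x _ <-]; exact: HM.
Qed.

Lemma mdist_le_rho (f g : X -> X) (x : X) : mdist (f x) (g x) <= rho f g.
Proof. by apply: ub_le_sup; [exact: rho_has_ubound | exists x]. Qed.

Lemma rho_le (f g : X -> X) (M : R) : 0 <= M ->
  (forall x, mdist (f x) (g x) <= M) -> rho f g <= M.
Proof.
move=> M0 HM; have [[p _]|X0] := pselect (exists p : X, True).
  by apply: ge_sup; [exists (mdist (f p) (g p)); exists p | move=> _ [x _ <-]].
rewrite /rho (_ : range (fun x => mdist (f x) (g x)) = set0) ?sup0//.
by rewrite -subset0 => r [x _ _]; apply: X0; exists x.
Qed.

Lemma rho_ge0 (f g : X -> X) : 0 <= rho f g.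
Proof.
have [[p _]|X0] := pselect (exists p : X, True).
  by apply: le_trans (mdist_le_rho f g p); exact: mdist_ge0.
rewrite /rho (_ : range (fun x => mdist (f x) (g x)) = set0) ?sup0//.
by rewrite -subset0 => r [x _ _]; apply: X0; exists x.
Qed.

Let rhoxx (f : cmap cX) : rho f f = 0.
Proof.
by apply/eqP; rewrite eq_le rho_ge0 andbT rho_le// => x; rewrite mdistxx.
Qed.

Let rho_positivity (f g : cmap cX) : rho f g = 0 -> f = g.
Proof.
move=> fg; apply/continuousEP => x; apply: mdist_positivity.
by apply/eqP; rewrite eq_le mdist_ge0 andbT -fg mdist_le_rho.
Qed.

Let rho_sym (f g : cmap cX) : rho f g = rho g f.
Proof.
by congr sup; apply: eq_imagel => x _; exact: metric_sym.
Qed.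

Let rho_triangle (g f h : cmap cX) : rho f h <= rho f g + rho g h.
Proof.
apply: rho_le => [|x]; first by rewrite addr_ge0 ?rho_ge0.
by apply: le_trans (metric_triangle _ (g x) _) _; rewrite lerD ?mdist_le_rho.
Qed.

HB.instance Definition _ := isMetric.Build R (cmap cX)
  rhoxx rho_positivity rho_sym rho_triangle.

Lemma cmap_mdistE (f g : cmap cX) : mdist f g = rho f g.
Proof. by []. Qed.

Lemma iter_continuous (f : cmap cX) (n : nat) : continuous (iter n f).
Proof.
elim: n => [|n IH] x; first exact: cvg_id.
by apply: (@continuous_comp _ _ _ (iter n f) f); [exact: IH | exact: cts_fun].
Qed.

Definition cmap_iter (f : cmap cX) (n : nat) : cmap cX :=
  mkcts (@iter_continuous f n).

End sup_metric.

Definition pseudo_orbit {R : realType} {X : metricType R}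
    (f : X -> X) (delta : R) (x : nat -> X) : Prop :=
  forall i : nat, mdist (f (x i)) (x i.+1) < delta.

Definition shadowing {R : realType} {X : metricType R} (f : X -> X) : Prop :=
  forall eps : R, 0 < eps -> exists2 delta : R, 0 < delta &
    forall x : nat -> X, pseudo_orbit f delta x ->
      exists z : X, forall i : nat, mdist (x i) (iter i f z) < eps.

(* On a nonempty space this is [exists p, forall x, f x = p]; it also makes the
   unique self-map of the empty space constant. *)
Definition constant_map {X : Type} (f : X -> X) : Prop :=
  forall x y : X, f x = f y.

(* Main.v *)
Require Import Defs.
From HB Require Import structures.
From mathcomp Require Import all_boot all_order all_algebra.
From mathcomp Require Import all_classical all_reals all_analysis.
From mathcomp Require Import lra.

(** Compactness of the space of self-maps gives two things: all continuous
self-maps of [X], hence all iterates of [f], share one modulus of continuity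
([compact_cmap_equicontinuous]), and the iterates have a cluster point for
uniform convergence.

Suppose [f] has shadowing.  Connectedness joins any two points [x] and [y] by
a chain [u] with small steps, eventually equal to [y].  By equicontinuity of
the iterates, [i |-> f^i (u i)] is a pseudo-orbit: it starts at [x] and
eventually coincides with the orbit of [y].  A point [z] shadowing it is close
to [x], so its orbit stays close to that of [x]; and its orbit is eventually
close to that of [y].  Hence any two orbits are asymptotic
([shadowing_asymptotic]).  By compactness the iterates have a uniform cluster
point [g], which is therefore constant, and its value is fixed by [f] because
[x] and [f x] are asymptotic.  Once a single iterate is uniformly close to this
fixed value, equicontinuity keeps all later iterates close to it, so the whole
sequence converges to [g] ([shadowing_cvg_constant]).

Conversely, suppose the iterates converge uniformly to a constant and let [N]
be such that all iterates from the [N]-th on are close to it.  For a small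
enough tolerance, [f^n (x i)] is close to [x (n + i)] for all [n <= N]
([pseudo_orbit_iter]).  Then [x 0] shadows the pseudo-orbit: up to time [N]
directly, and afterwards because both [x i], which is close to
[f^N (x (i - N))], and [f^i (x 0)] are close to the constant
([cvg_constant_shadowing]). *)

Import Order.TTheory GRing.Theory Num.Theory.

Local Open Scope classical_set_scope.
Local Open Scope ring_scope.

(** * Uniformity from compactness *)

(** The Lebesgue number argument, with an abstract property so that it applies
both to the points of a space, for uniform continuity, and to the points of a
space of maps, for equicontinuity. *)
Lemma compact_uniform_radius (R : realType) (M : metricType R)
    (P : R -> M -> Prop) :
  compact [set: M] ->
  (forall x, exists2 r, 0 < r &
    forall y d, mdist x y < r -> 0 < d -> d < r -> P d y) ->
  exists2 d, 0 < d & forall y, P d y.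
Proof.
move=> cM locP.
have : \forall d \near (0 : R)^'+, [set: M] `<=` P d.
  move/compact_near_coveringP : cM; apply => x _.
  have [r r0 Pr] := locP x.
  exists (ball x r, [set d | 0 < d < r]) => /=.
    split; first exact: nbhsx_ballx.
    by near=> d; apply/andP; split.
  by move=> [y d] /= [xy /andP[d0 dr]]; apply: Pr => //; rewrite ballEmdist in xy.
move=> Pd; near (0 : R)^'+ => d.
exists d => // y.
suff : [set: M] `<=` P d by exact.
by near: d.
Unshelve. all: by end_near. Qed.

Lemma compact_unif_continuous (R : realType) (M N : metricType R) (h : M -> N) :
  compact [set: M] -> continuous h -> forall e : R, 0 < e ->
  exists2 d, 0 < d & forall x y, mdist x y < d -> mdist (h x) (h y) < e.
Proof.
move=> cM ch e e0.
apply: (@compact_uniform_radius _ _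
  (fun d x => forall y, mdist x y < d -> mdist (h x) (h y) < e)) => // x.
have e20 : 0 < e / 2 by rewrite divr_gt0.
have /nbhs_ballP[r /= r0 xr] := ch x _ (nbhsx_ballx (h x) (e / 2) e20).
exists (r / 2) => [|y d xy d0 dr z yz]; first by rewrite divr_gt0.
have hr u : mdist x u < r -> mdist (h x) (h u) < e / 2.
  by move=> xu; have := xr u; rewrite /= !ballEmdist; exact.
have hy : mdist (h x) (h y) < e / 2 by apply: hr; lra.
have hz : mdist (h x) (h z) < e / 2.
  by apply: hr; have := metric_triangle x y z; lra.
by have := metric_triangle (h y) (h x) (h z); rewrite (metric_sym (h y) (h x)); lra.
Qed.

Definition unif_equicontinuous {R : realType} {M N : metricType R} {I : Type}
    (h : I -> M -> N) : Prop :=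
  forall e : R, 0 < e -> exists2 d, 0 < d &
    forall i x y, mdist x y < d -> mdist (h i x) (h i y) < e.

(** The easy half of the Arzela-Ascoli theorem: near a map [h] in the supremum
metric, the modulus of [h] for [e / 3] serves for [e]. *)
Lemma compact_cmap_equicontinuous (R : realType) (X : metricType R)
    (cX : compact [set: X]) :
  compact [set: cmap cX] -> unif_equicontinuous (fun h : cmap cX => h : X -> X).
Proof.
move=> cCX e e0.
apply: (@compact_uniform_radius _ (cmap cX)
  (fun d h => forall x y, mdist x y < d -> mdist (h x) (h y) < e)) => // h.
have e30 : 0 < e / 3 by rewrite divr_gt0.
have [d d0 hd] := @compact_unif_continuous _ _ _ h cX (@cts_fun _ _ h) _ e30.
exists (Num.min d (e / 3)) => [|k c]; first by rewrite lt_min d0.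
rewrite !lt_min => /andP[_ hk] c0 /andP[cd _] x y xy.
have hkx u : mdist (h u) (k u) < e / 3.
  exact: le_lt_trans (mdist_le_rho cX h k u) hk.
have hxy : mdist (h x) (h y) < e / 3 by apply: hd; lra.
have := metric_triangle (k x) (h x) (k y).
have := metric_triangle (h x) (h y) (k y).
by have := hkx x; have := hkx y; rewrite (metric_sym (k x) (h x)); lra.
Qed.

(** * From shadowing to convergence *)

(** The points that chains of step below [e] join to [x] form a clopen set.  Chains are
sequences that are eventually constant rather than finite lists because their
images under the iterates must be infinite pseudo-orbits. *)
Lemma connected_chain (R : realType) (X : metricType R) :
  connected [set: X] -> forall (e : R) (x y : X), 0 < e ->
  exists (u : nat -> X) (m : nat),
    [/\ u 0%N = x, forall i, (m <= i)%N -> u i = y &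
        forall i, mdist (u i) (u i.+1) < e].
Proof.
move=> cX e x y e0.
pose A := [set z | exists (u : nat -> X) (m : nat),
    [/\ u 0%N = x, forall i, (m <= i)%N -> u i = z &
        forall i, mdist (u i) (u i.+1) < e]].
have stepA z w : A z -> mdist z w < e -> A w.
  move=> [u [m [u0 um ue]]] zw.
  exists (fun i => if (i <= m)%N then u i else w), m.+1; split => //.
    by move=> i mi; rewrite leqNgt mi.
  move=> i; case: (ltngtP i m) => // im.
    by rewrite mdistxx.
  by rewrite im um.
have oA : open A.
  rewrite openE => z Az; apply/nbhs_ballP; exists e => //= w.
  by rewrite ballEmdist; exact: stepA.
have clA : closed A.
  move=> z /(_ (ball z e)) [|w [Aw]]; first exact: nbhsx_ballx.
  by rewrite ballEmdist /= metric_sym; exact: stepA.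
suff AT : A = [set: X] by change (A y); rewrite AT.
apply: cX.
- by exists x, (fun=> x), 0%N; split => // i; rewrite mdistxx.
- by exists A => //; rewrite setTI.
- by exists A => //; rewrite setTI.
Qed.

(** Moving slowly along a chain from [x] to [y] while iterating is permitted
by the tolerance, so a single true orbit must start near [x] and end up near
the orbit of [y]. *)
Lemma shadowing_asymptotic (R : realType) (X : metricType R) (f : X -> X) :
  connected [set: X] -> unif_equicontinuous (fun n => iter n f) ->
  shadowing f ->
  forall (x y : X) (e : R), 0 < e ->
  exists m : nat, forall i, (m <= i)%N -> mdist (iter i f x) (iter i f y) < e.
Proof.
move=> cX eqf shf x y e e0.
have e20 : 0 < e / 2 by rewrite divr_gt0.
have [c c0 fc] := eqf _ e20.
have [|d d0 shd] := shf (Num.min c (e / 2)); first by rewrite lt_min c0.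
have [b b0 fb] := eqf _ d0.
have [u [m [u0 um ub]]] := connected_chain _ _ cX _ x y b0.
have [|z zu] := shd (fun i => iter i f (u i)).
  by move=> i; rewrite -iterS; apply: fb.
exists m => i mi.
have := zu 0%N; have := zu i; rewrite /= u0 (um _ mi) !lt_min.
move=> /andP[_ yz] /andP[xz _].
have := fc i _ _ xz.
have := metric_triangle (iter i f x) (iter i f z) (iter i f y).
by rewrite (metric_sym (iter i f z)); lra.
Qed.

(** Any cluster point of the iterates is a constant map because orbits are
asymptotic to each other; the fixed value of this map attracts all points
uniformly by equicontinuity. *)
Lemma shadowing_cvg_constant (R : realType) (X : metricType R)
    (cX : compact [set: X]) (f : cmap cX) :
  connected [set: X] -> compact [set: cmap cX] -> shadowing f ->
  exists2 g : cmap cX, constant_map g & cmap_iter f @ \oo --> g.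
Proof.
move=> connX cCX shf.
have eqf : unif_equicontinuous (fun n => iter n f).
  move=> e e0; have [d d0 hd] := compact_cmap_equicontinuous _ _ _ cCX _ e0.
  by exists d => // n; exact: (hd (cmap_iter f n)).
have asy := shadowing_asymptotic _ _ _ connX eqf shf.
have [g [_ clg]] := cCX (cmap_iter f @ \oo) _ filterT.
have gcl (e : R) (N : nat) : 0 < e -> exists2 n, (N <= n)%N &
    forall x, mdist (g x) (iter n f x) < e.
  move=> e0.
  have [|h [[n /= Nn <-]]] := clg [set cmap_iter f n | n in [set n | (N <= n)%N]]
      (ball g e) _ (nbhsx_ballx g e e0).
    by exists N => // n Nn; exists n.
  rewrite ballEmdist /= => gn; exists n => // x.
  exact: le_lt_trans (mdist_le_rho cX g (cmap_iter f n) x) gn.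
have lim_eq (x y : X) : (forall e, 0 < e -> mdist x y < e) -> x = y.
  move=> xy; apply/eqP; rewrite -[_ == _]negbK -mdist_gt0; apply/negP.
  by move=> /xy; rewrite ltxx.
have gconst : constant_map g.
  move=> x y; apply: lim_eq => e e0.
  have e30 : 0 < e / 3 by rewrite divr_gt0.
  have [m xym] := asy x y _ e30.
  have [n /xym xyn gn] := gcl _ m e30.
  have := gn x; have := gn y.
  have := metric_triangle (g x) (iter n f x) (g y).
  have := metric_triangle (iter n f x) (iter n f y) (g y).
  by rewrite (metric_sym (iter n f y)); lra.
have gfix x : f (g x) = g x.
  apply: lim_eq => e e0.
  have e30 : 0 < e / 3 by rewrite divr_gt0.
  have [d d0 fd] := eqf _ e30.
  have [m xym] := asy (f x) x _ e30.
  have [|n /xym xyn gn] := gcl (Num.min d (e / 3)) m; first by rewrite lt_min d0.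
  (* [f] itself is the iterate of index 1, so its modulus comes from [eqf]. *)
  have := gn x; rewrite lt_min => /andP[/(fd 1%N)/= fgx gx].
  move: xyn; rewrite -iterSr /= => xyn.
  have := metric_triangle (f (g x)) (f (iter n f x)) (g x).
  have := metric_triangle (f (iter n f x)) (iter n f x) (g x).
  by rewrite (metric_sym (iter n f x)); lra.
exists g => //; apply/cvg_ballP => e e0.
have e20 : 0 < e / 2 by rewrite divr_gt0.
have [d d0 fd] := eqf _ e20.
have [n _ gn] := gcl _ 0%N d0.
exists n => // k /= nk; rewrite ballEmdist /=.
apply: (@le_lt_trans _ _ (e / 2)); last by lra.
apply: rho_le => [|x]; first exact: ltW.
(* For [k >= n] the [k]-th iterate of [x] is the [k - n]-th iterate of a point
   within [d] of the fixed point [g x]. *)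
have iterg j : iter j f (g x) = g x by elim: j => //= j ->.
have := fd (k - n)%N _ _ (gn x).
by rewrite iterg -iterD subnK//; exact: ltW.
Qed.

(** * From convergence to shadowing *)

(** Errors accumulated over boundedly many steps are controlled by uniform
continuity of [f] alone, one step at a time. *)
Lemma pseudo_orbit_iter (R : realType) (X : metricType R) (f : X -> X) :
  (forall e : R, 0 < e -> exists2 d, 0 < d &
    forall x y, mdist x y < d -> mdist (f x) (f y) < e) ->
  forall (N : nat) (e : R), 0 < e -> exists2 d, 0 < d &
  forall x, pseudo_orbit f d x ->
  forall i n, (n <= N)%N -> mdist (iter n f (x i)) (x (n + i)%N) < e.
Proof.
move=> ucf; elim=> [|N IH] e e0.
  by exists 1 => // x _ i n; rewrite leqn0 => /eqP ->; rewrite mdistxx.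
have e20 : 0 < e / 2 by rewrite divr_gt0.
have [c c0 fc] := ucf _ e20.
have [|d d0 IHd] := IH (Num.min c e); first by rewrite lt_min c0.
exists (Num.min d (e / 2)) => [|x xd i n]; first by rewrite lt_min d0.
have xd' : pseudo_orbit f d x.
  by move=> j; have := xd j; rewrite lt_min => /andP[].
rewrite leq_eqVlt => /orP[/eqP -> | nN]; last first.
  by have := IHd _ xd' i n nN; rewrite lt_min => /andP[].
have := IHd _ xd' i N (leqnn N); rewrite lt_min => /andP[/fc].
have := xd (N + i)%N; rewrite lt_min => /andP[_].
by have := metric_triangle (f (iter N f (x i))) (f (x (N + i)%N)) (x (N.+1 + i)%N);
  rewrite /= addSn; lra.
Qed.

(** A pseudo-orbit forgets its past: [N] iterations of [f] send any point close
to the constant, so from time [N] on only the errors of the last [N] steps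
separate the pseudo-orbit from it, and errors never accumulate over longer
times. *)
Lemma cvg_constant_shadowing (R : realType) (X : metricType R) (f : X -> X)
    (p : X -> X) :
  constant_map p ->
  (forall e : R, 0 < e -> exists2 d, 0 < d &
    forall x y, mdist x y < d -> mdist (f x) (f y) < e) ->
  (forall e : R, 0 < e -> exists N, forall n, (N <= n)%N ->
    forall x, mdist (p x) (iter n f x) < e) ->
  shadowing f.
Proof.
move=> pc ucf fp e e0.
have e30 : 0 < e / 3 by rewrite divr_gt0.
have [N fN] := fp _ e30.
have [d d0 trk] := pseudo_orbit_iter _ _ _ ucf N _ e30.
exists d => // x xd; exists (x 0%N) => i.
have [iN|Ni] := leqP i N.
  by have := trk x xd 0%N i iN; rewrite addn0 metric_sym; lra.
have iE : (i = N + (i - N))%N by rewrite subnKC// ltnW.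
have := trk x xd (i - N)%N N (leqnn N); rewrite -iE.
have := fN N (leqnn N) (x (i - N)%N).
have := fN i (ltnW Ni) (x 0%N).
rewrite (pc (x 0%N) (x (i - N)%N)).
set q := p _; set a := iter N f _; set b := iter i f _.
have := metric_triangle (x i) a b; have := metric_triangle a q b.
by rewrite (metric_sym (x i) a) (metric_sym a q); lra.
Qed.

Theorem corollary29 (R : realType) (X : metricType R)
    (cX : compact [set: X]) (connX : connected [set: X])
    (cCX : compact [set: cmap cX]) (f : cmap cX) :
  shadowing f <->
  exists2 g : cmap cX, constant_map g & cmap_iter f @ \oo --> g.
Proof.
split; first exact: shadowing_cvg_constant.
move=> [g gc /cvg_ballP fg]; apply: (cvg_constant_shadowing _ _ _ _ gc).
  exact: compact_unif_continuous cX (@cts_fun _ _ f).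
move=> e /fg[N _ fN]; exists N => n /fN; rewrite /= ballEmdist /= => gn x.
exact: le_lt_trans (mdist_le_rho cX g (cmap_iter f n) x) gn.
Qed.
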